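(* Let $X=\bigcup_{i=1}^\infty(2^i\mathbb{Z})^i$ (disjoint union over $i$) be equipped with the following metric $d$: for $a=(a_1,\dots,a_l)\in(2^l\mathbb{Z})^l$ and $b=(b_1,\dots,b_k)\in(2^k\mathbb{Z})^k$ with $l\le k$, put $a'=(a_1,\dots,a_l,0,\dots,0)\in\mathbb{Z}^k$, put $c=0$ if $l=k$ and $c=l+(l+1)+\dots+(k-1)$ if $l<k$, and set $d(a,b)=\max\{d_{\max}(a',b),c\}$, where $d_{\max}$ is the maximum metric on $\mathbb{Z}^k$. Equip $X\times X$ with the metric $d_{X\times X}((x,y),(x',y'))=\max\{d(x,x'),d(y,y')\}$. Then $\operatorname{coasdim}(X\times X)<fin+fin$ is not true.
   Context: Here $j\mathbb{Z}=\{jt:t\in\mathbb{Z}\}$. For subsets $U,V$ of a metric space $(X,d)$, $\operatorname{diam}U=\sup\{d(x,y):x,y\in U\}$ and $d(U,V)=\inf\{d(x,y):x\in U,y\in V\}$. A family $\mathcal{U}$ of subsets is $R$-bounded if $\operatorname{diam}U\le R$ for all $U\in\mathcal{U}$, uniformly bounded if it is $R$-bounded for some $R>0$, and $r$-disjoint if $d(U,V)\ge r$ for all $U\ne V$ in $\mathcal{U}$. $\bigcup\mathcal{U}$ denotes the union of the members of $\mathcal{U}$. $\operatorname{asdim}X\le n$ means: for every $r>0$ there are uniformly bounded, $r$-disjoint families $\mathcal{U}_0,\dots,\mathcal{U}_n$ of subsets of $X$ such that $\bigcup_{i=0}^n\mathcal{U}_i$ covers $X$. $\operatorname{coasdim}(X)\le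 fin+k$ means that for every $n\in\mathbb{N}$ there exist $R>0$, $m\in\mathbb{N}$ and $n$-disjoint, $R$-bounded families $\mathcal{U}_1,\dots,\mathcal{U}_k$ of subsets of $X$ such that $\operatorname{asdim}\big(X\setminus\bigcup(\bigcup_{i=1}^k\mathcal{U}_i)\big)\le m$. $\operatorname{coasdim}(X)<fin+fin$ means that $\operatorname{coasdim}(X)\le fin+k$ for some $k\in\mathbb{N}$. *)

(* Defs.v *)
From HB Require Import structures.
From mathcomp Require Import all_boot all_order all_algebra.
From mathcomp Require Import zify.
From mathcomp Require Import boolp classical_sets reals constructive_ereal.
From mathcomp Require Import ereal topology.

Set Implicit Arguments.
Unset Strict Implicit.
Unset Printing Implicit Defensive.

Import Order.TTheory GRing.Theory Num.Theory.

Local Open Scope classical_set_scope.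
Local Open Scope ring_scope.

Section CoarseDimension.
Context {R : realType} {T : metricType R}.
Implicit Types (A B Y : set T) (F : set (set T)).

(* With values in \bar R, the diameter of the empty set is -oo and its
   distance to any set is +oo, so empty members are harmless in a family. *)
Definition diam A : \bar R :=
  ereal_sup [set (mdist p.1 p.2)%:E | p in A `*` A].

Definition set_dist A B : \bar R :=
  ereal_inf [set (mdist p.1 p.2)%:E | p in A `*` B].

Definition bounded_family (r : R) F : Prop :=
  forall A, F A -> (diam A <= r%:E)%E.

Definition uniformly_bounded F : Prop :=
  exists2 r : R, 0 < r & bounded_family r F.

Definition disjoint_family (r : R) F : Prop :=
  forall A B, F A -> F B -> A <> B -> (r%:E <= set_dist A B)%E.

Definition family_union F : set T := \bigcup_(A in F) A.

(* asdim Y <= n for Y a subset of T with the restricted metric; the members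
   of the families are subsets of Y. *)
Definition asdim_le Y (n : nat) : Prop :=
  forall r : R, 0 < r ->
  exists U : 'I_n.+1 -> set (set T),
    [/\ forall i A, U i A -> A `<=` Y,
        forall i, uniformly_bounded (U i),
        forall i, disjoint_family r (U i)
      & Y `<=` \bigcup_(i in [set: 'I_n.+1]) family_union (U i)].

End CoarseDimension.

Definition coasdim_le_fin_plus {R : realType} (T : metricType R) (k : nat) :
    Prop :=
  forall n : nat, exists (r : R) (m : nat) (U : 'I_k -> set (set T)),
    [/\ 0 < r,
        forall i, disjoint_family n%:R (U i),
        forall i, bounded_family r (U i)
      & asdim_le
          ([set: T] `\` \bigcup_(i in [set: 'I_k]) family_union (U i)) m].

Definition coasdim_lt_fin_fin {R : realType} (T : metricType R) : Prop :=
  exists k : nat, coasdim_le_fin_plus T k.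

(* The maximum metric on a product, compatible with the library's product
   pseudometric structure. *)
Section ProductMetric.
Context {R : realType} {T1 T2 : metricType R}.
Implicit Types x y : T1 * T2.

Definition prod_mdist x y : R :=
  Num.max (mdist x.1 y.1) (mdist x.2 y.2).

Let prod_mdist_ge0 x y : 0 <= prod_mdist x y.
Proof. by rewrite /prod_mdist le_max mdist_ge0. Qed.

Let prod_mdist_positivity x y : prod_mdist x y = 0 -> x = y.
Proof.
case: x y => [x1 x2] [y1 y2]; rewrite /prod_mdist /= => xy0.
have := lexx (0 : R); rewrite -{1}xy0 ge_max => /andP[h1 h2].
by congr (_, _); apply: mdist_positivity; apply/eqP;
  rewrite eq_le mdist_ge0 andbT.
Qed.

Let prod_ballE x (e : R) : ball x e = [set y | prod_mdist x y < e].
Proof.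
apply/seteqP; split => y /=.
- by case; rewrite /prod_mdist gt_max !ballEmdist /= => -> ->.
- rewrite /prod_mdist gt_max => /andP[h1 h2].
  by split; rewrite ballEmdist.
Qed.

HB.instance Definition _ := PseudoMetric_isMetric.Build R (T1 * T2)%type
  prod_mdist_ge0 prod_mdist_positivity prod_ballE.

End ProductMetric.

(* (2 ^ i Z) ^ i *)
Definition lattice (i : nat) : Type :=
  {v : 'rV[int]_i | [forall j, (2%:Z ^+ i %| v ord0 j)%Z]}.

HB.instance Definition _ i := Choice.on (lattice i).

(* The disjoint union of the (2 ^ i Z) ^ i for i >= 1: the tag l stands for
   i = l + 1. The phantom R fixes the field in which distances are taken, as
   needed to attach a canonical metric to the type. *)
Definition lattice_union (R : realType) : Type := {l : nat & lattice l.+1}.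

HB.instance Definition _ R := Choice.on (lattice_union R).

Definition pad (l k : nat) (a : 'rV[int]_l) : 'rV[int]_k :=
  \row_(j < k) (if insub (val j) is Some i then a ord0 i else 0).

Definition dmax (k : nat) (u v : 'rV[int]_k) : nat :=
  \max_(j < k) `|u ord0 j - v ord0 j|%N.

(* To be used only for l <= k; the sum l + (l + 1) + ... + (k - 1) is empty
   when l = k. *)
Definition padded_dist (l k : nat) (a : 'rV[int]_l) (b : 'rV[int]_k) : nat :=
  maxn (dmax (pad k a) b) (\sum_(l <= i < k) i)%N.

Section LatticeUnion.
Context {R : realType}.
Implicit Types a b c : lattice_union R.

Definition level a : nat := (tag a).+1.

Definition coords a : 'rV[int]_(level a) := val (tagged a).

Definition lattice_dist a b : nat :=
  if (level a <= level b)%N then padded_dist (coords a) (coords b)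
  else padded_dist (coords b) (coords a).

(* The j-th coordinate, extended by 0. *)
Let ext (l : nat) (a : 'rV[int]_l) (j : nat) : int :=
  if insub j is Some i then a ord0 i else 0.

Let ext_out l (a : 'rV[int]_l) j : (l <= j)%N -> ext a j = 0.
Proof. by rewrite /ext => lj; case: insubP => [i|//]; rewrite ltnNge lj. Qed.

Let ext_ord l (a : 'rV[int]_l) (j : 'I_l) : ext a j = a ord0 j.
Proof. by rewrite /ext valK. Qed.

Let padded_distP l k (a : 'rV[int]_l) (b : 'rV[int]_k) N : (l <= k)%N ->
  (padded_dist a b <= N)%N <->
  (forall j, (`|ext a j - ext b j| <= N)%N) /\
  (\sum_(0 <= i < k) i <= N + \sum_(0 <= i < l) i)%N.
Proof.
move=> lk; rewrite /padded_dist geq_max.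
rewrite (big_cat_nat (leq0n l) lk) //= [(N + _)%N]addnC leq_add2l.
suff e : (dmax (pad k a) b <= N)%N <->
    (forall j, (`|ext a j - ext b j| <= N)%N).
  by split=> [/andP[/e]|[/e ? ?]] //; apply/andP.
split=> [/bigmax_leqP h j|h].
- case: (ltnP j k) => jk.
    have := h (Ordinal jk) isT; rewrite /pad mxE.
    by rewrite -(ext_ord b (Ordinal jk)).
  by rewrite !ext_out // (leq_trans lk).
- by apply/bigmax_leqP => j _; rewrite /pad mxE -(ext_ord b j); apply: h.
Qed.

Let lattice_distP a b N : (lattice_dist a b <= N)%N <->
  [/\ forall j, (`|ext (coords a) j - ext (coords b) j| <= N)%N,
      (\sum_(0 <= i < level a) i <= N + \sum_(0 <= i < level b) i)%N
    & (\sum_(0 <= i < level b) i <= N + \sum_(0 <= i < level a) i)%N].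
Proof.
have mono l k : (l <= k)%N ->
    (\sum_(0 <= i < l) i <= N + \sum_(0 <= i < k) i)%N.
  by move=> lk; rewrite (big_cat_nat (leq0n l) lk) //= addnCA leq_addr.
rewrite /lattice_dist.
have [ab|/(@ltnW (level b) (level a)) ba] := leqP (level a) (level b).
- by rewrite padded_distP //; split=> [[? ?]|[? ? ?]]; split=> //; exact: mono.
- rewrite padded_distP //; split=> [[h ?]|[h ? ?]]; split=> //;
    try exact: mono; by move=> j; rewrite distnC.
Qed.

Let lattice_distxx a : lattice_dist a a = 0%N.
Proof.
apply/eqP; rewrite -leqn0; apply/lattice_distP; split=> // j.
by rewrite subrr.
Qed.

Let lattice_distC a b : lattice_dist a b = lattice_dist b a.
Proof.
by apply/eqP; rewrite eqn_leq; apply/andP; split; apply/lattice_distP;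
  have /lattice_distP[h ? ?] := leqnn (lattice_dist b a);
  have /lattice_distP[h' ? ?] := leqnn (lattice_dist a b);
  split=> // j; rewrite distnC.
Qed.

Let lattice_dist_triangle b a c :
  (lattice_dist a c <= lattice_dist a b + lattice_dist b c)%N.
Proof.
have /lattice_distP[h1 p1 q1] := leqnn (lattice_dist a b).
have /lattice_distP[h2 p2 q2] := leqnn (lattice_dist b c).
apply/lattice_distP; split; [|lia|lia].
by move=> j; have := h1 j; have := h2 j; lia.
Qed.

Let lattice_dist_eq0 a b : lattice_dist a b = 0%N -> a = b.
Proof.
move/eqP; rewrite -leqn0 => /lattice_distP[].
case: a b => [l [u up]] [k [v vp]]; rewrite /coords /level /=.
rewrite !add0n => h p q.
have lk : l = k.
  have {q}pq : (\sum_(0 <= i < l.+1) i = \sum_(0 <= i < k.+1) i)%N.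
    by apply/eqP; rewrite eqn_leq p q.
  have strict m n : (m < n)%N ->
      (\sum_(0 <= i < m.+1) i < \sum_(0 <= i < n.+1) i)%N.
    move=> mn; rewrite [ltnRHS](big_cat_nat (leq0n m.+1)) /=; last exact: ltnW.
    rewrite -[X in (X < _)%N]addn0 ltn_add2l big_nat_recr //=.
    by rewrite addn_gt0 (leq_ltn_trans (leq0n m) mn) orbT.
  by case: (ltngtP l k) => // /strict; rewrite pq ltnn.
case: k / lk v vp h {p q} => v vp h; congr existT; apply/val_inj => /=.
apply/rowP => j; have := h j; rewrite !ext_ord leqn0 absz_eq0 subr_eq0.
by move/eqP.
Qed.

Let lattice_mdist a b : R := (lattice_dist a b)%:R.

Let lattice_mdistxx a : lattice_mdist a a = 0.
Proof. by rewrite /lattice_mdist lattice_distxx. Qed.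

Let lattice_mdist_positivity a b : lattice_mdist a b = 0 -> a = b.
Proof.
by move/eqP; rewrite /lattice_mdist pnatr_eq0 => /eqP; exact: lattice_dist_eq0.
Qed.

Let lattice_mdistC a b : lattice_mdist a b = lattice_mdist b a.
Proof. by rewrite /lattice_mdist lattice_distC. Qed.

Let lattice_mdist_triangle b a c :
  lattice_mdist a c <= lattice_mdist a b + lattice_mdist b c.
Proof. by rewrite /lattice_mdist -natrD ler_nat lattice_dist_triangle. Qed.

HB.instance Definition _ := isMetric.Build R (lattice_union R)
  lattice_mdistxx lattice_mdist_positivity lattice_mdistC
  lattice_mdist_triangle.

End LatticeUnion.

Lemma lattice_mdistE (R : realType) (a b : lattice_union R) :
  mdist a b = (lattice_dist a b)%:R :> R.
Proof. by []. Qed.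

Lemma prod_mdistE (R : realType) (T1 T2 : metricType R) (x y : T1 * T2) :
  mdist x y = Num.max (mdist x.1 y.1) (mdist x.2 y.2) :> R.
Proof. by []. Qed.

(* Main.v *)
(* Kuhn's lemma: if functions f_i on the grid {0, ..., N}^k vanish on the face
   x_i = 0 and equal 1 on the face x_i = N, then on some unit cell no f_i is
   constant. Indeed the mod 2 cup product df_1 \cup ... \cup df_k is the
   coboundary of f_1 df_2 \cup ... \cup df_k, so its sum over the cube
   telescopes to the faces x_1 = 0, N of lower dimension, and is 1 by induction.

   Hence, if a grid of dimension k is coloured with k colours and each colour
   class is cut into pieces such that points at distance at most 2 are in the
   same piece, then some piece is as long as the grid. So k separated bounded
   families cannot cover a copy of a large grid of dimension k.

   Given k families in the product, separated at scale n > 2 * 2^(k+1), every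
   slice (2^(k+1) Z)^(k+1) x {y} has therefore an uncovered point (g(y), y) with
   g(y) in a fixed bounded set. The map y |-> (g(y), y) is a coarse embedding of
   X into the uncovered set, and asdim X is infinite by the same covering
   argument in (2^(m+1) Z)^(m+1). *)
From mathcomp Require Import all_boot all_order all_algebra.
From mathcomp Require Import zify lra.
From mathcomp Require Import boolp classical_sets reals constructive_ereal.
From mathcomp Require Import ereal topology.
Require Import Defs.

Set Implicit Arguments.
Unset Strict Implicit.
Unset Printing Implicit Defensive.

Import Order.TTheory GRing.Theory Num.Theory.

Local Open Scope ring_scope.

Local Notation grid k N := {ffun 'I_k -> 'I_N.+1}.

(** * Kuhn's lemma through mod 2 cochains on the grid *)

Section Kuhn.
Variables k N : nat.
Implicit Types (x y : grid k N) (i j : 'I_k) (C : {set 'I_k}) (s : seq 'I_k).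
Implicit Type w : {set 'I_k} -> grid k N -> 'F_2.

(* Cyclic, so that it is a bijection of the grid. *)
Definition shift j x : grid k N := [ffun i => if i == j then ordS (x i) else x i].

(* [w C x] is the value of a cochain on the cube at [x] with directions [C]. *)
Definition coboundary w C x : 'F_2 :=
  \sum_(j in C) (w (C :\ j) (shift j x) + w (C :\ j) x).

Let add2 (a : 'F_2) : a + a = 0.
Proof. exact: addrr_pchar2. Qed.

Lemma ordS_eq0 (n : nat) (i : 'I_n.+1) : (ordS i == ord0) = (i == ord_max).
Proof.
rewrite -!val_eqE /=; have := ltn_ord i; rewrite ltnS leq_eqVlt.
case: eqVneq => [->|/= _ iN]; first by rewrite modnn.
by rewrite modn_small.
Qed.

Lemma shiftC i j x : shift i (shift j x) = shift j (shift i x).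
Proof. by apply/ffunP => l; rewrite !ffunE; case: eqP; case: eqP. Qed.

Lemma shift_bij j : bijective (shift j).
Proof.
exists (fun x => [ffun i => if i == j then ord_pred (x i) else x i] : grid k N) => x;
  by apply/ffunP => i; rewrite !ffunE; case: eqP => // _; rewrite ?ordSK ?ord_predK.
Qed.

(** Each unordered pair of indices contributes twice, which cancels mod 2. *)
Lemma sum_offdiag_sym C (h : 'I_k -> 'I_k -> 'F_2) :
  (forall i j, h i j = h j i) -> \sum_(j in C) \sum_(i in C :\ j) h j i = 0.
Proof.
move=> hC.
pose L := \sum_(j in C) \sum_(i in C | (i < j)%N) h j i.
transitivity (L + L); last exact: add2.
rewrite {2}/L [X in L + X](exchange_big_dep (mem C)) /=; last by move=> ? ? _ /andP[].
rewrite -big_split; apply: eq_bigr => j jC /=.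
rewrite (bigID (fun i : 'I_k => (i < j)%N)) /=; congr (_ + _).
  apply: eq_bigl => i; rewrite !inE; case: eqVneq => [->|//].
  by rewrite ltnn !andbF.
apply: eq_big => [i|i _]; last exact: hC.
by rewrite !inE jC /= -leqNgt ltn_neqAle [(j : nat) == i]eq_sym andbAC andbC andbA.
Qed.

Lemma coboundary_coboundary w C x : coboundary (coboundary w) C x = 0.
Proof.
rewrite /coboundary; under eq_bigr do rewrite -big_split.
apply: sum_offdiag_sym => i j; rewrite [C :\ i :\ j]finset.setDDl [C :\ j :\ i]finset.setDDl.
rewrite (finset.setUC [set i]) (shiftC i). exact: addrACA.
Qed.

Variable f : 'I_k -> grid k N -> 'F_2.

(* The cup product of the [df_i] for [i] in [s]. *)
Fixpoint cup s C x : 'F_2 :=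
  if s is i :: s' then
    \sum_(j in C) (f i (shift j x) + f i x) * cup s' (C :\ j) (shift j x)
  else (C == finset.set0)%:R.

(* [df \cup w = d(f w)] when [dw = 0]. *)
Lemma cup_closed_cons i s C x : coboundary (cup s) C x = 0 ->
  cup (i :: s) C x = coboundary (fun C' y => f i y * cup s C' y) C x.
Proof.
move=> cl; rewrite -[LHS]addr0.
have -> : 0 = f i x * coboundary (cup s) C x by rewrite cl mulr0.
rewrite /coboundary mulr_sumr -big_split; apply: eq_bigr => j _ /=.
by rewrite mulrDl mulrDr addrA -[X in X + _]addrA add2 addr0.
Qed.

(** By induction the cup product over [i :: s] is the coboundary of [f i] times the one over [s],
    and a coboundary is closed. *)
Lemma cup_closed s C x : coboundary (cup s) C x = 0.
Proof.
elim: s C x => [|i s IHs] C x.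
  by rewrite /coboundary big1 // => j _; rewrite add2.
rewrite -[RHS](coboundary_coboundary (fun C' y => f i y * cup s C' y) C x).
by rewrite {1 2}/coboundary; apply: eq_bigr => j _; rewrite !cup_closed_cons.
Qed.

Definition in_cell C x y : bool :=
  [exists A : {set 'I_k}, (A \subset C) &&
    (y == [ffun i => if i \in A then ordS (x i) else x i])].

(** The factor df_i vanishes on every edge of the cube, and the recursion in [cup] only passes to
    faces of that cube. *)
Lemma cup_eq0 s C x i (b : 'F_2) : i \in s ->
  (forall y, in_cell C x y -> f i y = b) -> cup s C x = 0.
Proof.
elim: s C x => // i' s IHs C x is_ fb /=; apply: big1 => j jC.
have cellj y : in_cell (C :\ j) (shift j x) y -> in_cell C x y.
  move=> /existsP[A /andP[AC /eqP->]]; apply/existsP; exists (j |: A).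
  rewrite finset.subUset finset.sub1set jC (fintype.subset_trans AC) ?finset.subD1set //=.
  apply/eqP/ffunP => l; rewrite !ffunE !inE; case: eqVneq => //= ->.
  by case: ifP => // /(fintype.subsetP AC); rewrite !inE eqxx.
have [/eqP ii'|ii'] := boolP (i' == i); last first.
  rewrite (IHs (C :\ j)) ?mulr0 //; last by move=> y /cellj /fb.
  by move: is_; rewrite inE eq_sym (negPf ii').
rewrite ii' !fb ?add2 ?mul0r //; apply/existsP.
  exists finset.set0; rewrite finset.sub0set; apply/eqP/ffunP => l; by rewrite !ffunE inE.
exists [set j]; rewrite finset.sub1set jC; apply/eqP/ffunP => l; by rewrite !ffunE inE.
Qed.

Hypothesis f0 : forall i x, x i = ord0 -> f i x = 0.
Hypothesis fN : forall i x, x i = ord_max -> f i x = 1.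

(** Base points of the cubes with directions [C] in the face where all other coordinates are [N].
    Coordinates in [C] are below [N], so these cubes do not wrap around. *)
Definition box C : {set grid k N} :=
  [set x : grid k N | [forall i, (i \in C) == (x i != ord_max)]].

Lemma sum_cup s : uniq s ->
  \sum_(x in box [set i in s]) cup s [set i in s] x = 1.
Proof.
elim: s => [_|i s IHs].
  rewrite (big_pred1 [ffun=> ord_max]) => [|x /=].
    by rewrite /= (_ : _ == _ = true) //; apply/eqP/finset.setP => i; rewrite !inE.
  rewrite inE; apply/forallP/eqP => [xN|-> i]; last by rewrite ffunE inE eqxx.
  by apply/ffunP => i; rewrite ffunE; have := xN i; rewrite !inE; case: (x i =P ord_max).
case/andP=> is_ us; rewrite -(IHs us).
set C := [set _ in i :: s].
have Ci : C :\ i = [set j in s].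
  by apply/finset.setP => j; rewrite !inE; case: eqVneq => // ->; rewrite (negPf is_).
under eq_bigr do rewrite (cup_closed_cons _ (cup_closed _ _ _)).
rewrite /coboundary exchange_big /=.
have iC : i \in C by rewrite !inE eqxx.
pose g j (y : grid k N) := f i y * cup s (C :\ j) y.
(* [box C] with coordinate [j] set free. *)
pose D j := [set y : grid k N | [forall l, (l != j) ==> ((l \in C) == (y l != ord_max))]].
have boxD j y : j \in C -> (y \in box C) = (y \in D j) && (y j != ord_max).
  move=> jC; rewrite !inE; apply/forallP/andP => [yC|[/forallP yD yj] l].
    split; first by apply/forallP => l; rewrite yC implybT.
    by rewrite -(eqP (yC j)).
  by have := yD l; case: eqVneq => //= ->; rewrite jC yj.
have Dshift j y : (shift j y \in D j) = (y \in D j).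
  by rewrite !inE; apply: eq_forallb => l; rewrite ffunE; case: eqVneq.
(* After reindexing by the shift, interior points are counted twice and cancel; only the ends [y j]
   = 0 and [N] remain. *)
have tele j : j \in C -> \sum_(x in box C) (g j (shift j x) + g j x) =
    \sum_(y in D j) ((y j != ord0)%:R + (y j != ord_max)%:R) * g j y.
  move=> jC; rewrite big_split /=; under [RHS]eq_bigr do rewrite mulrDl.
  rewrite big_split /=; congr (_ + _).
    rewrite [RHS](reindex _ (onW_bij _ (shift_bij j))) /= [LHS]big_mkcond [RHS]big_mkcond.
    apply: eq_bigr => x _; rewrite (boxD j) // Dshift !ffunE eqxx ordS_eq0.
    by case: (x \in D j); case: (x j != ord_max); rewrite ?mul1r ?mul0r.
  rewrite [LHS]big_mkcond [RHS]big_mkcond; apply: eq_bigr => x _; rewrite (boxD j) //.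
  by case: (x \in D j); case: (x j != ord_max); rewrite ?mul1r ?mul0r.
(* On either end face [f j] is constant, and df_j is a factor of the cup product over [s]. *)
have tele0 j : j \in C -> j != i -> \sum_(x in box C) (g j (shift j x) + g j x) = 0.
  move=> jC ji; rewrite tele // big1 // => y _.
  have js : j \in s by move: jC; rewrite !inE (negPf ji).
  have cellj z : in_cell (C :\ j) y z -> z j = y j.
    move=> /existsP[A /andP[AC /eqP->]]; rewrite ffunE; case: ifP => // /(fintype.subsetP AC).
    by rewrite !inE eqxx.
  case: (eqVneq (y j) ord0) => [y0|_].
    by rewrite /g (cup_eq0 js (b := 0)) ?mulr0 // => z /cellj zj; rewrite f0 ?zj.
  case: (eqVneq (y j) ord_max) => [yN|_]; last by rewrite add2 mul0r.
  by rewrite /g (cup_eq0 js (b := 1)) ?mulr0 // => z /cellj zj; rewrite fN ?zj.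
rewrite (bigD1 i) //= [X in _ + X]big1 ?addr0; last by move=> j /andP[]; exact: tele0.
rewrite (tele i) // [LHS]big_mkcond [RHS]big_mkcond; apply: eq_bigr => y _.
have -> : (y \in box [set j in s]) = (y \in D i) && (y i == ord_max).
  rewrite !inE; apply/forallP/andP => [yC|[/forallP yD yi] l].
    split; last by have := yC i; rewrite inE (negPf is_); case: (y i == ord_max).
    by apply/forallP => l; apply/implyP => li; have := yC l; rewrite !inE (negPf li).
  have := yD l; rewrite !inE; case: eqVneq => //= ->.
  by rewrite (negPf is_) yi.
case: (y \in D i) => //=; rewrite /g Ci.
(* Only the face [y i] = [N] contributes, with [f i] = 1. The two ends coincide only when [N] = 0,
   where [f0] contradicts [fN]. *)
case: (eqVneq (y i) ord_max) => [yN|yN]; case: (eqVneq (y i) ord0) => [y0|y0] /=.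
- by have := fN yN; rewrite f0.
- by rewrite fN // addr0 !mul1r.
- by rewrite f0 // mul0r mulr0.
- by rewrite add2 mul0r.
Qed.

Lemma kuhn : exists x, forall i (b : 'F_2), exists2 y : grid k N,
  (forall j, (x j <= y j <= (x j).+1)%N) & f i y != b.
Proof.
have Ck : [set i in enum 'I_k] = [set: 'I_k].
  by apply/finset.setP => i; rewrite !inE mem_enum.
have := sum_cup (enum_uniq 'I_k); rewrite Ck => sum1.
have [x xbox cup_neq0] : exists2 x, x \in box [set: 'I_k] & cup (enum 'I_k) [set: 'I_k] x != 0.
  apply/exists_inP; apply: contraT => /exists_inPn cup0.
  by move: sum1; rewrite big1 // => x /cup0 /negPn /eqP.
exists x => i b.
have /forall_inPn[y ycell fy] :
    ~~ [forall (y | in_cell [set: 'I_k] x y), f i y == b].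
  apply: contraNN cup_neq0 => /forall_inP cellb.
  by apply/eqP/(cup_eq0 (i := i) (b := b)); [rewrite mem_enum|move=> y /cellb/eqP].
exists y => // j; move: ycell => /existsP[A /andP[_ /eqP->]]; rewrite ffunE.
case: ifP => _; last by rewrite leqnn leqnSn.
(* Since [x j] is not [N], [ordS] is the true successor here. *)
move: xbox; rewrite inE => /forallP/(_ j); rewrite inE => /eqP/esym.
rewrite -val_eqE /= => xj; rewrite modn_small ?leqnn ?leqnSn //.
by have := ltn_ord (x j); rewrite !ltnS leq_eqVlt (negPf xj).
Qed.
End Kuhn.

(** * Separated bounded families on a grid *)

Definition close (k N e : nat) (x y : grid k N) : bool :=
  [forall j, (x j <= y j + e)%N && (y j <= x j + e)%N].

Lemma closeP (k N e : nat) (x y : grid k N) :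
  reflect (forall j, (x j <= y j + e)%N /\ (y j <= x j + e)%N) (close e x y).
Proof. by apply: (iffP forallP) => xy j; apply/andP. Qed.

Lemma long_component (k N : nat) (T : eqType)
    (c : grid k N -> 'I_k) (m : grid k N -> T) :
  (forall x y, close 2 x y -> c x = c y -> m x = m y) ->
  exists x y i, [/\ c x = c y, m x = m y & (y i + N <= x i + 2)%N].
Proof.
move=> cm; apply: contrapT => short.
have {}short x y i : c x = c y -> m x = m y -> (x i + 2 < y i + N)%N.
  move=> cxy mxy; rewrite ltnNge; apply/negP => xy.
  by apply: short; exists x, y, i.
have N_gt2 : (2 < N)%N.
  by have := short [ffun=> ord0] [ffun=> ord0] (c [ffun=> ord0]); rewrite ffunE; exact.
(* [W i] is the part of colour [i] whose pieces come near the face [x i = 0].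
   If [c x = i], then [f i] is constant on the neighbours of [x]: it is 0 if
   [W i x] and 1 otherwise. *)
pose W (i : 'I_k) x :=
  (c x == i) && [exists y : grid k N, [&& c y == i, m y == m x & (y i <= 1)%N]].
pose f (i : 'I_k) (x : grid k N) : 'F_2 :=
  ((x i != ord0) && ~~ [exists y, W i y && close 1 x y])%:R.
have [||x xcell] := @kuhn k N f.
- by move=> i x xi; rewrite /f xi eqxx.
- move=> i x xi; rewrite /f xi -val_eqE /= -lt0n (leq_trans _ N_gt2) //=.
  case: existsP => // -[y /andP[/andP[/eqP cy /existsP[z /and3P[/eqP cz /eqP mz zi]]] /closeP/(_ i)[]]].
  (* The piece would reach from [z i] at most 1 to [y i] at least [N] - 1; this is the origin of the
     slack 2 in the conclusion. *)
  have := short y z i; rewrite cy cz mz xi /= => /(_ erefl erefl); lia.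
pose i := c x; have [Wx|Wx] := boolP (W i x).
- have [y xy] := xcell i 0; rewrite /f (_ : [exists _, _] = true) ?andbF //.
  apply/existsP; exists x; rewrite Wx; apply/closeP => j; have := xy j; lia.
- have xi : (2 <= x i)%N.
    rewrite ltnNge; apply: contraNN Wx => xi; rewrite /W eqxx.
    by apply/existsP; exists x; rewrite !eqxx.
  have [y xy] := xcell i 1; rewrite /f -val_eqE /= -lt0n.
  rewrite (leq_trans _ (proj1 (andP (xy i)))) ?(leq_trans _ xi) //=.
  case: existsP => // -[z /andP[Wz /closeP yz]] _; case/negP: Wx.
  (* Both [x] and [z] are within 1 of [y], hence radius 2 in the hypothesis on pieces; [z] then lies
     in the piece of [x], which forces [W i x]. *)
  have xz : close 2 x z by apply/closeP => j; have := xy j; have := yz j; lia.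
  case/andP: Wz => /eqP cz; rewrite -(cm _ _ xz) ?cz // /W eqxx => zP.
  by rewrite zP.
Qed.

(** Otherwise colour each point by the index of a family covering it, with the covering member as
    its piece: a long piece would exceed the diameter bound [b]. *)
Lemma uncovered_point (R : realType) (M : metricType R) (k n N : nat)
    (F : 'I_n -> set (set M)) (r b : R) (p : grid k N -> M) :
  (n <= k)%N -> (forall i, disjoint_family r (F i)) ->
  (forall i, bounded_family b (F i)) -> b + 2 < N%:R ->
  (forall x y, close 2 x y -> mdist (p x) (p y) < r) ->
  (forall (x y : grid k N) (i : 'I_k), (x i)%:R <= (y i)%:R + mdist (p x) (p y)) ->
  exists x, ~ (\bigcup_(i in [set: 'I_n]) family_union (F i))%classic (p x).
Proof.
move=> nk Fr Fb bN pr pexp; apply: contrapT => covered.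
have /choice[cA cAP] : forall x, exists cA : 'I_n * set M, F cA.1 cA.2 /\ cA.2 (p x).
  move=> x; apply: contrapT => xF; apply: covered; exists x => -[i _ [A FA Ax]].
  by apply: xF; exists (i, A).
have [x y|x [y [i [_ Axy xy]]]] :=
    @long_component k N (set M) (widen_ord nk \o fst \o cA) (snd \o cA).
  move=> /pr xy /= /(congr1 val) /= /val_inj cxy; apply: contrapT => Axy.
  have [Fx Ax] := cAP x; have [Fy Ay] := cAP y; rewrite -cxy in Fy.
  have := Fr _ _ _ Fx Fy Axy; apply/negP; rewrite -ltNge.
  apply: (@le_lt_trans _ _ (mdist (p x) (p y))%:E); last by rewrite lte_fin.
  by apply: ereal_inf_lbound; exists (p x, p y).
have [Fx Ax] := cAP x; have [_ Ay] := cAP y; rewrite /= in Axy; rewrite -Axy in Ay.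
have xyb : mdist (p x) (p y) <= b.
  rewrite -lee_fin; apply: le_trans (Fb _ _ Fx).
  by apply: ereal_sup_ubound; exists (p x, p y).
have := pexp x y i; move: xy; rewrite -(ler_nat R) !natrD; lra.
Qed.

(** * Copies of grids in the lattice union *)

Section LatticeGrid.
Variables (R : realType) (d N : nat).
Implicit Types x y : grid d.+1 N.

Definition scaled_row x : 'rV[int]_d.+1 := \row_j (2 ^ d.+1 * x j)%N%:Z.

Fact scaled_row_dvd x : [forall j, (2%:Z ^+ d.+1 %| scaled_row x ord0 j)%Z].
Proof. by apply/forallP => j; rewrite mxE PoszM -rmorphXn dvdz_mulr. Qed.

Definition lattice_grid x : lattice_union R :=
  existT (fun l => lattice l.+1) d
    (exist (fun v : 'rV_d.+1 => [forall j, (2%:Z ^+ d.+1 %| v ord0 j)%Z])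
       (scaled_row x) (scaled_row_dvd x)).

Lemma lattice_grid_dist x y : lattice_dist (lattice_grid x) (lattice_grid y) =
  \max_(j < d.+1) `|(2 ^ d.+1 * x j)%N%:Z - (2 ^ d.+1 * y j)%N%:Z|%N.
Proof.
rewrite /lattice_dist leqnn /padded_dist big_geq // maxn0 /dmax.
by apply: eq_bigr => j _; rewrite /pad /coords /= !mxE valK mxE.
Qed.

Lemma lattice_grid_close e x y : close e x y ->
  mdist (lattice_grid x) (lattice_grid y) <= (e * 2 ^ d.+1)%:R.
Proof.
move=> /closeP xy; rewrite lattice_mdistE ler_nat lattice_grid_dist.
apply/bigmax_leqP => j _; have := xy j; nia.
Qed.

Lemma lattice_grid_expand x y i :
  (x i)%:R <= (y i)%:R + mdist (lattice_grid x) (lattice_grid y).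
Proof.
rewrite lattice_mdistE -natrD ler_nat lattice_grid_dist.
apply: leq_trans (leq_add (leqnn _) (leq_bigmax i)).
have := expn_gt0 2 d.+1; nia.
Qed.
End LatticeGrid.

Theorem proposition4p1 (R : realType) :
  ~ coasdim_lt_fin_fin (lattice_union R * lattice_union R)%type.
Proof.
move=> [k /(_ (2 * 2 ^ k.+1).+1)[b [m [U [b_gt0 Udisj Ubdd]]]]].
set Y := (_ `\` _)%classic => asdimY.
have natgt (a : R) : exists N : nat, a < N%:R.
  by exists (Num.truncn a).+1; exact: truncnS_gt.
(* [N] is chosen before [y], so that all values of [g] lie in one finite grid. *)
have [N bN] := natgt (b + 2).
have /choice[g gY] : forall y : lattice_union R, exists x : grid k.+1 N,
    Y (lattice_grid R x, y).
  move=> y; have [||x xU] := uncovered_point (k := k.+1)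
      (p := fun x => (lattice_grid R x, y)) (leqnSn k) Udisj Ubdd bN.
  - by move=> x x' /(lattice_grid_close R) xx'; rewrite prod_mdistE /= mdistxx gt_max ltr0n andbT (le_lt_trans xx') // ltr_nat.
  - move=> x x' i; rewrite prod_mdistE; apply: le_trans (lattice_grid_expand R x x' i) _.
    by rewrite lerD2l le_max lexx.
  - by exists x.
(* The first summand bounds the distance between any two values of [g] in the lattice, the second
   that between grid points at most 2 apart in dimension [m.+1]. *)
pose r : R := (N * 2 ^ k.+1 + 2 * 2 ^ m.+1).+1%:R.
have [|V [_ Vbdd Vdisj Vcov]] := asdimY r; first by rewrite ltr0n.
have /choice[bs bsP] : forall i, exists bi : R, 0 < bi /\ bounded_family bi (V i).
  by move=> i; have [bi ? ?] := Vbdd i; exists bi.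
(* The sum serves as one bound common to all the families. *)
have Vbdd' i : bounded_family (\sum_j bs j) (V i).
  move=> A VA; apply: le_trans (proj2 (bsP i) A VA) _; rewrite lee_fin.
  by rewrite (bigD1 i) //= lerDl sumr_ge0 // => j _; case: (bsP j) => /ltW.
have [N' bN'] := natgt (\sum_j bs j + 2).
pose p (x : grid m.+1 N') := (lattice_grid R (g (lattice_grid R x)), lattice_grid R x).
have [||x] := uncovered_point (k := m.+1) (p := p) (leqnn _) Vdisj Vbdd' bN'.
- move=> x y /(lattice_grid_close R) xy; rewrite prod_mdistE gt_max /=; apply/andP; split.
    have gxy : close N (g (lattice_grid R x)) (g (lattice_grid R y)).
      by apply/closeP => j; have := ltn_ord (g (lattice_grid R x) j);
        have := ltn_ord (g (lattice_grid R y) j); lia.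
    by apply: le_lt_trans (lattice_grid_close R gxy) _; rewrite ltr_nat; lia.
  by apply: le_lt_trans xy _; rewrite ltr_nat; lia.
- move=> x y i; rewrite prod_mdistE; apply: le_trans (lattice_grid_expand R x y i) _.
  by rewrite lerD2l le_max lexx orbT.
- by apply; apply: Vcov; exact: gY.
Qed.
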